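(* Let $F=F(a_1,\dots,a_k)$ be a free group of rank $k\ge2$ and let $\phi\in Aut(F)$ be an arbitrary automorphism. Then the following hold. (1) Either $\phi$ is simple and $I(\phi)=\{1\}$ or, else, $1$ belongs to the interior of $\overline{I(\phi)}$. (2) There exists $w\in F$, $w\ne1$, such that $\|\phi(w)\|=\|w\|$.
   Context: For $w\in F$, $\|w\|$ is the cyclically reduced length of $w$ with respect to the basis $\{a_1,\dots,a_k\}$, i.e. the length of any cyclically reduced word conjugate to $w$. The conjugacy distortion spectrum of $\phi\in Aut(F)$ is $$I(\phi):=\left\{\frac{\|\phi(w)\|}{\|w\|}: w\in F\setminus\{1\}\right\}\subseteq\mathbb Q,$$ and $\overline{I(\phi)}$ is its closure in $\mathbb R$. An automorphism of $F$ is a relabeling automorphism if it is induced by a permutation of $\{a_1,\dots,a_k\}^{\pm1}$; it is simple if it is the composition of a relabeling automorphism and an inner automorphism. *)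

(* Defs.v *)
From HB Require Import structures.
From mathcomp Require Import all_boot all_order all_algebra all_fingroup.
From mathcomp Require Import all_classical all_reals all_analysis.

Set Implicit Arguments.
Unset Strict Implicit.
Unset Printing Implicit Defensive.

Import Order.TTheory GRing.Theory Num.Theory.
Import numFieldNormedType.Exports.

Local Open Scope classical_set_scope.
Local Open Scope group_scope.

(* The alphabet {a_1, ..., a_k}^{+-1}: [(i, true)] is the generator a_(i+1) and
   [(i, false)] its inverse. *)
Definition letter (k : nat) : finType := ('I_k * bool)%type.

Definition linv k (l : letter k) : letter k := (l.1, ~~ l.2).

Definition nocancel k : rel (letter k) := fun l m => m != linv l.

Definition reduced k (s : seq (letter k)) : bool := sorted (@nocancel k) s.

Record free_group (k : nat) : Type :=
  FreeGroup { word : seq (letter k); wordP : reduced word }.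

HB.instance Definition _ k := [isSub for @word k].
HB.instance Definition _ k := [Choice of free_group k by <:].

(* Reduced form of l s, for s reduced. *)
Definition push k (l : letter k) (s : seq (letter k)) : seq (letter k) :=
  if s is m :: s' then if nocancel l m then l :: s else s' else [:: l].

Section FreeGroupStructure.
Variable k : nat.
Implicit Types (l m : letter k) (s t : seq (letter k)) (u v w g : free_group k).

Lemma linvK : involutive (@linv k).
Proof. by case=> i b; rewrite /linv /= negbK. Qed.

Lemma nocancel_linv l m : nocancel (linv m) (linv l) = nocancel l m.
Proof.
by rewrite /nocancel linvK eq_sym -(inj_eq (inv_inj linvK)) linvK.
Qed.

Lemma push_reduced l s : reduced s -> reduced (push l s).
Proof.
case: s => [|m s] //= sP; case: ifP => [lm|_] /=; first by rewrite lm.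
exact: path_sorted sP.
Qed.

Lemma push_path l s : path (@nocancel k) l s -> push l s = l :: s.
Proof. by case: s => [|m s] //= /andP[->]. Qed.

Lemma pushK l s : reduced s -> push (linv l) (push l s) = s.
Proof.
case: s => [|m s] /=; first by rewrite /nocancel linvK eqxx.
case: ifP => [_|/negbFE/eqP -> /push_path //] /= _.
by rewrite /nocancel linvK eqxx.
Qed.

Lemma foldr_push_reduced s t : reduced t -> reduced (foldr (@push k) t s).
Proof. by move=> tP; elim: s => //= l s; apply: push_reduced. Qed.

Lemma foldr_push_cat s t : reduced (s ++ t) -> foldr (@push k) t s = s ++ t.
Proof.
elim: s => //= l s IH lst; rewrite IH ?push_path //; exact: path_sorted lst.
Qed.

Lemma foldr_push s : reduced s -> foldr (@push k) [::] s = s.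
Proof. by move=> sP; rewrite foldr_push_cat cats0. Qed.

Lemma foldr_push_push l s t : reduced t ->
  foldr (@push k) t (push l s) = push l (foldr (@push k) t s).
Proof.
move=> tP; case: s => [|m s] //=; case: ifP => // /negbFE/eqP ->.
by have /= := pushK (linv l) (foldr_push_reduced s tP); rewrite linvK => ->.
Qed.

Lemma inv_reduced s : reduced s -> reduced (rev (map (@linv k) s)).
Proof.
rewrite /reduced rev_sorted sorted_map => h; apply: sub_sorted h => l m.
by rewrite /= nocancel_linv.
Qed.

Definition fg_of_seq s : free_group k :=
  FreeGroup (@foldr_push_reduced s [::] isT).

Definition fg_one : free_group k := @FreeGroup k [::] isT.

Definition fg_mul u v : free_group k :=
  FreeGroup (foldr_push_reduced (word u) (wordP v)).

Definition fg_inv u : free_group k := FreeGroup (inv_reduced (wordP u)).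

Lemma fg_mul1 : left_id fg_one fg_mul.
Proof. by move=> u; apply: val_inj. Qed.

Lemma fg_mulA : associative fg_mul.
Proof.
move=> u v w; apply: val_inj => /=; elim: (word u) => //= l s ->.
by rewrite foldr_push_push ?wordP.
Qed.

Lemma fg_mulg1 : right_id fg_one fg_mul.
Proof. by move=> u; apply: val_inj; rewrite /= foldr_push ?wordP. Qed.

Lemma fg_mulVr : right_inverse fg_one fg_inv fg_mul.
Proof.
move=> u; apply: val_inj; rewrite /=.
have: reduced (word u) := wordP u.
elim/last_ind: (word u) => //= s l IH sl.
rewrite map_rcons rev_rcons foldr_rcons /=.
have rs: reduced s by move: sl; rewrite /reduced -cats1 => /cat_sorted2[].
by rewrite {1}/nocancel eqxx IH.
Qed.

Lemma fg_invK : involutive fg_inv.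
Proof.
move=> u; apply: val_inj; rewrite /= map_rev revK -map_comp.
by rewrite map_id_in // => l _; apply: linvK.
Qed.

Lemma fg_mulVl : left_inverse fg_one fg_inv fg_mul.
Proof. by move=> u; rewrite -{2}(fg_invK u) fg_mulVr. Qed.

End FreeGroupStructure.

HB.instance Definition _ k := isGroup.Build (free_group k)
  (@fg_mulA k) (@fg_mul1 k) (@fg_mulg1 k) (@fg_mulVl k) (@fg_mulVr k).

Definition fg_letter k (l : letter k) : free_group k := @FreeGroup k [:: l] isT.

Definition conjugate k (u w : free_group k) : Prop := exists g, u = w ^ g.

(* Reduced, and the last letter does not cancel the first one. *)
Definition cyclically_reduced k (u : free_group k) : bool :=
  path.cycle (@nocancel k) (word u).

(* [xget 1] picks some element of the set; the set is never empty and all its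
   elements have the same length, see [cyclic_lengthP]. *)
Definition cyclic_length k (w : free_group k) : nat :=
  size (word (xget 1 [set u | cyclically_reduced u /\ conjugate u w])).

Section CyclicLengthWellDefined.
Variable k : nat.
Implicit Types (l m : letter k) (s t : seq (letter k)) (u v w g : free_group k).

Lemma word_inj : injective (@word k).
Proof. exact: val_inj. Qed.

Lemma fg_of_seq_cat s t : fg_of_seq (s ++ t) = fg_of_seq s * fg_of_seq t.
Proof.
apply: val_inj => /=; elim: s => //= l s ->.
by rewrite foldr_push_push // foldr_push_reduced.
Qed.

Lemma fg_of_seq_word u : fg_of_seq (word u) = u.
Proof. by apply: val_inj; rewrite /= foldr_push ?wordP. Qed.

Lemma fg_letterV l : fg_letter (linv l) = (fg_letter l)^-1.
Proof. exact: val_inj. Qed.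

Lemma size_foldr_push s t : (size (foldr (@push k) t s) <= size s + size t)%N.
Proof.
elim: s => //= l s IH; case: (foldr _ _ _) IH => //= m r IH.
by case: ifP => _ /=; rewrite ?addSn ?ltnS // ltnW // ltnW.
Qed.

Lemma size_mul u v : (size (word (u * v)%g) <= size (word u) + size (word v))%N.
Proof. exact: size_foldr_push. Qed.

Lemma size_inv u : size (word u^-1) = size (word u).
Proof. by rewrite /= size_rev size_map. Qed.

Lemma size_exp u n : cyclically_reduced u ->
  size (word (u ^+ n)) = (n * size (word u))%N.
Proof.
move=> cu; suff: word (u ^+ n) = flatten (nseq n (word u)).
  by move=> ->; elim: n => //= n IH; rewrite size_cat IH mulSn.
elim: n => // n IH; rewrite expgS /=.
rewrite [LHS]/(foldr _ _ _) -/(foldr _ _ _) IH foldr_push_cat //.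
move: cu; rewrite /cyclically_reduced; case: (word u) => [|x p] /=.
  by move=> _; elim: (n).
rewrite rcons_path => /andP[xp lx]; rewrite /reduced /= cat_path xp /=.
by elim: (n) => //= r IHr; rewrite lx cat_path xp.
Qed.

Lemma conjugate_leq_size u v : cyclically_reduced u -> cyclically_reduced v ->
  conjugate u v -> (size (word u) <= size (word v))%N.
Proof.
move=> cu cv [g ug]; rewrite leqNgt; apply/negP => vu.
pose n := (size (word g) + size (word g)).+1.
have: (size (word (u ^+ n)%g) <= size (word g) + (n * size (word v) + size (word g)))%N.
  rewrite ug -conjXg conjgE -size_exp //.
  by apply: leq_trans (size_mul _ _) _; rewrite size_inv leq_add2l size_mul.
rewrite size_exp // addnCA leqNgt => /negP; apply.
apply: leq_trans (leq_mul (leqnn n) vu); rewrite mulnS addnC.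
by rewrite ltn_add2r /n ltnS.
Qed.

Lemma cyclically_reduced_exists w :
  exists u, cyclically_reduced u /\ conjugate u w.
Proof.
move: {2}(size _) (leqnn (size (word w))) => n.
elim: n w => [|n IH] w wn.
  exists w; split; last by exists 1; rewrite conjg1.
  by rewrite /cyclically_reduced; case: (word w) wn.
have [cw|] := boolP (cyclically_reduced w).
  by exists w; split => //; exists 1; rewrite conjg1.
rewrite /cyclically_reduced; have rw := wordP w.
case E: (word w) rw wn => [|x p] //=; case/lastP: p E => [|q y] E.
  by rewrite /= andbT /nocancel; case: (x) => i []; rewrite xpair_eqE /= andbF.
rewrite [path _ _ (rcons (rcons _ _) _)]rcons_path last_rcons => -> /=.
rewrite size_rcons !ltnS => qn; rewrite /nocancel => /negbNE/eqP xy.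
have wE : w = fg_letter x * fg_of_seq q * (fg_letter x)^-1.
  rewrite -[LHS]fg_of_seq_word E -cats1 -cat1s catA !fg_of_seq_cat -fg_letterV.
  by congr (_ * _ * _); apply: val_inj; rewrite //= xy linvK.
have [|u [cu [g ug]]] := IH (fg_of_seq q).
  by apply: leq_trans (size_foldr_push _ _) _; rewrite addn0 ltnW.
exists u; split => //; exists (fg_letter x * g).
suff -> : w ^ (fg_letter x * g) = fg_of_seq q ^ g by [].
by rewrite conjgM wE; congr (_ ^ g); rewrite conjgE !mulgA mulVg mul1g mulgKV.
Qed.

Lemma cyclic_lengthP w u :
  cyclically_reduced u -> conjugate u w -> cyclic_length w = size (word u).
Proof.
move=> cu [g ug]; rewrite /cyclic_length.
case: xgetP => [v _ [cv [h vh]]|h]; last by case: (h u); split => //; exists g.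
apply/eqP; rewrite eqn_leq !conjugate_leq_size //.
  by exists (h^-1 * g); rewrite vh -conjgM mulgA mulgV mul1g.
by exists (g^-1 * h); rewrite ug -conjgM mulgA mulgV mul1g.
Qed.

End CyclicLengthWellDefined.

Definition distortion_spectrum k (phi : free_group k -> free_group k) : set rat :=
  [set ((cyclic_length (phi w))%:R / (cyclic_length w)%:R)%R
     | w in [set w : free_group k | w != 1]].

(* Such a permutation s automatically commutes with [linv], as psi is a
   morphism. *)
Definition relabeling k (psi : {multiplicative free_group k -> free_group k}) :
    Prop :=
  bijective psi /\
  exists s : {perm letter k}, forall l, psi (fg_letter l) = fg_letter (s l).

Definition simple_aut k (phi : free_group k -> free_group k) : Prop :=
  exists psi : {multiplicative free_group k -> free_group k},
    relabeling psi /\ exists g, forall w, phi w = psi w ^ g.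

(* Main.v *)
Require Import Defs.
From HB Require Import structures.
From mathcomp Require Import all_boot all_order all_algebra all_fingroup.
From mathcomp Require Import all_classical all_reals all_analysis.
From mathcomp Require Import zify ring lra.
Import Order.TTheory GRing.Theory Num.Theory.
Import numFieldNormedType.Exports.
Local Open Scope classical_set_scope.

(* If [phi] does not increase the cyclic length of any product of at most two
   generators, then [phi] is simple: the [phi a_i] are conjugates of letters
   whose axes in the Cayley tree pairwise meet, hence share a vertex.  Applied
   to [phi] and to its inverse, this gives, for [phi] not simple, u and v with
   ||phi u|| < ||u|| and ||phi v|| > ||v||.  No power of u is then conjugate to
   a power of v, so cancellation between large powers of u and v stabilizes:
   ||prod_i u^m_i v^n_i|| = sum_i (m_i ||u|| + n_i ||v|| + K) for a constant K
   and all large m_i, n_i, and likewise for the images under [phi].  The words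
   u^m v^n thus have distortions dense around 1.  If u^m v^n is lengthened by
   d > 0 and u^m' v^n' is shortened by d' > 0, then
   (u^m v^n)^d' (u^m' v^n')^d keeps its length. *)

(** * Morphisms between groups *)

Section GroupMorphisms.
Local Open Scope group_scope.
Set Implicit Arguments.
Unset Strict Implicit.
Variables (G H : groupType) (f : {multiplicative G -> H}).

Lemma multiplicative1 : f 1 = 1.
Proof. by apply: (mulgI (f 1)); rewrite -gmulfM !mulg1. Qed.

Lemma multiplicativeV : {morph f : x / x^-1}.
Proof. by move=> x; apply: (mulgI (f x)); rewrite -gmulfM !mulgV multiplicative1. Qed.

Lemma multiplicativeJ : {morph f : x y / x ^ y}.
Proof. by move=> x y; rewrite !conjgE !gmulfM multiplicativeV. Qed.

Lemma multiplicativeX n : {morph f : x / x ^+ n}.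
Proof.
by move=> x; elim: n => [|n IH]; rewrite ?expg0 ?multiplicative1 // !expgS gmulfM IH.
Qed.

End GroupMorphisms.

(** * Reduced words, cancellation in products, and cyclic length *)

Section Words.
Set Implicit Arguments.
Unset Strict Implicit.
Local Open Scope group_scope.
Variable k : nat.
Implicit Types (l m : letter k) (s t r : seq (letter k)) (u v w g h : free_group k).

(** Reducedness constrains adjacent letters only, and a nonempty [t] keeps [s] and [r] apart, so
    every adjacent pair lies in [s ++ t] or in [t ++ r]. *)
Lemma reduced_glue s t r : t != [::] ->
  reduced (s ++ t) -> reduced (t ++ r) -> reduced (s ++ t ++ r).
Proof.
rewrite /reduced; case: t => // x t _; case: s => [|y s] //=.
by rewrite !cat_path /= !cat_path => /and3P[-> -> ->].
Qed.

Lemma reduced_catl s t : reduced (s ++ t) -> reduced s.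
Proof. by case/cat_sorted2. Qed.

Lemma reduced_catr s t : reduced (s ++ t) -> reduced t.
Proof. by case/cat_sorted2. Qed.

Lemma cycle_nocancel s : path.cycle (@nocancel k) s = reduced (s ++ s).
Proof.
case: s => [|x s] //=; rewrite rcons_path /reduced /= cat_path /=.
by case: (path _ _ _); rewrite //= andbT.
Qed.

Lemma cyclically_reducedE u : cyclically_reduced u = reduced (word u ++ word u).
Proof. exact: cycle_nocancel. Qed.

Lemma word_mul_reduced u v :
  reduced (word u ++ word v) -> word (u * v) = word u ++ word v.
Proof. exact: foldr_push_cat. Qed.

Lemma word_fg_of_seq s : reduced s -> word (fg_of_seq s) = s.
Proof. exact: foldr_push. Qed.

Lemma word_eq0 u : (word u == [::]) = (u == 1).
Proof. by rewrite -(inj_eq (@word_inj k)). Qed.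

Lemma fg_of_seq0 : fg_of_seq [::] = 1 :> free_group k.
Proof. exact: val_inj. Qed.

Lemma fg_of_seq1 l : fg_of_seq [:: l] = fg_letter l.
Proof. exact: val_inj. Qed.

Lemma fg_of_seq_rev s :
  fg_of_seq (rev (map (@linv k) s)) = (fg_of_seq s)^-1.
Proof.
elim: s => [|l s IH]; first by rewrite fg_of_seq0 invg1.
rewrite -cat1s map_cat rev_cat !fg_of_seq_cat invMg IH; congr (_ * _).
by rewrite !fg_of_seq1 fg_letterV.
Qed.

(** Here [c] is the part of [u] absorbed by [v]. Sizes, letter counts and prefixes of a product can
    then be read off without unfolding [push]. *)
Lemma cancellation u v : exists a b c,
  [/\ word u = a ++ c, word v = rev (map (@linv k) c) ++ b,
      reduced (a ++ b) & word (u * v) = a ++ b].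
Proof.
suff [a [b [c [uE vE ab]]]] : exists a b c, [/\ word u = a ++ c,
    word v = rev (map (@linv k) c) ++ b & reduced (a ++ b)].
  exists a, b, c; split=> //.
  rewrite -(fg_of_seq_word u) -(fg_of_seq_word v) uE vE !fg_of_seq_cat.
  by rewrite fg_of_seq_rev -mulgA mulVKg -fg_of_seq_cat word_fg_of_seq.
have := wordP u; have := wordP v; move: (word u) (word v) => s t.
elim/last_ind: s t => [|s x IH] t tP sP; first by exists [::], t, [::].
case: t tP => [|y t] tP; first by exists (rcons s x), [::], [::]; rewrite cats0.
have [xy|] := boolP (nocancel x y).
  exists (rcons s x), (y :: t), [::]; split; rewrite ?cats0 //.
  by rewrite -cats1 -catA; apply: reduced_glue; rewrite ?cats1 //=; apply/andP.
move/negbNE/eqP => yE.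
have [||a [b [c [-> -> ab]]]] := IH t.
- exact: reduced_catr (_ : reduced ([:: y] ++ t)).
- by move: sP; rewrite -cats1; apply: reduced_catl.
exists a, b, (rcons c x); split=> //; first by rewrite rcons_cat.
by rewrite map_rcons rev_rcons yE.
Qed.

Lemma reduced_nseq s n : reduced (s ++ s) -> reduced (flatten (nseq n s)).
Proof.
case: (eqVneq s [::]) => [-> _|s0 ss]; first by elim: n.
have rs := reduced_catl ss.
suff : reduced (s ++ flatten (nseq n s)) by apply: reduced_catr.
by elim: n => [|n IH] /=; [rewrite cats0 | apply: reduced_glue].
Qed.

Lemma word_exp u n : cyclically_reduced u ->
  word (u ^+ n) = flatten (nseq n (word u)).
Proof.
rewrite cyclically_reducedE => uu; elim: n => // n IH.
rewrite expgS word_mul_reduced IH // -/(flatten (nseq n.+1 _)).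
exact: (@reduced_nseq _ n.+1).
Qed.

Lemma cyclically_reduced_exp u n : cyclically_reduced u ->
  cyclically_reduced (u ^+ n).
Proof.
move=> cu; have := cu; rewrite !cyclically_reducedE => uu.
have -> : word (u ^+ n) ++ word (u ^+ n) = flatten (nseq (n + n) (word u)).
  by rewrite word_exp // nseqD flatten_cat.
exact: reduced_nseq.
Qed.

Lemma cyclically_reducedV u : cyclically_reduced u -> cyclically_reduced u^-1.
Proof.
rewrite !cyclically_reducedE /= -rev_cat -map_cat; exact: inv_reduced.
Qed.

Lemma cyclic_length_conj w g : cyclic_length (w ^ g) = cyclic_length w.
Proof.
have [u [cu [h uE]]] := cyclically_reduced_exists w.
rewrite (cyclic_lengthP cu) ?(@cyclic_lengthP _ w u) //; first by exists h.
by exists (g^-1 * h); rewrite -conjgM mulVKg.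
Qed.

Lemma cyclic_length_reduced u :
  cyclically_reduced u -> cyclic_length u = size (word u).
Proof. by move=> cu; apply: cyclic_lengthP => //; exists 1; rewrite conjg1. Qed.

Lemma cyclic_lengthX w n : cyclic_length (w ^+ n) = (n * cyclic_length w)%N.
Proof.
have [u [cu [h uE]]] := cyclically_reduced_exists w.
rewrite -(cyclic_length_conj w h) -(cyclic_length_conj _ h) conjXg -uE.
by rewrite !cyclic_length_reduced ?cyclically_reduced_exp // Defs.size_exp.
Qed.

Lemma cyclic_lengthV w : cyclic_length w^-1 = cyclic_length w.
Proof.
have [u [cu [h uE]]] := cyclically_reduced_exists w.
rewrite -(cyclic_length_conj w h) -(cyclic_length_conj _ h) conjVg -uE.
by rewrite !cyclic_length_reduced ?cyclically_reducedV // size_inv.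
Qed.

Lemma cyclic_length_eq0 w : (cyclic_length w == 0%N) = (w == 1).
Proof.
have [u [cu [h uE]]] := cyclically_reduced_exists w.
rewrite -(cyclic_length_conj w h) -uE cyclic_length_reduced // size_eq0 word_eq0.
by rewrite uE conjg_eq1.
Qed.

Lemma cyclic_length_gt0 w : (0 < cyclic_length w)%N = (w != 1).
Proof. by rewrite lt0n cyclic_length_eq0. Qed.

(** Let |x| be the size of [word x]. If [u] is cyclically reduced and equal to [w ^ h], comparing
    powers gives n|u| <= n|w| + 2|h|; taking n > 2|h| excludes |u| > |w|. *)
Lemma cyclic_length_le w : (cyclic_length w <= size (word w))%N.
Proof.
have [u [cu [h uE]]] := cyclically_reduced_exists w.
rewrite leqNgt; apply/negP => lt; pose n := (size (word h) + size (word h)).+1.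
have: (size (word (u ^+ n)) <= size (word h) + (n * size (word w) + size (word h)))%N.
  rewrite uE -conjXg conjgE.
  apply: leq_trans (Defs.size_mul _ _) _; rewrite size_inv leq_add2l.
  apply: leq_trans (Defs.size_mul _ _) _; rewrite leq_add2r.
  elim: (n) => // m IH; rewrite expgS mulSn.
  by apply: leq_trans (Defs.size_mul _ _) _; rewrite leq_add2l.
move: lt; rewrite Defs.size_exp // -(cyclic_length_conj w h) -uE.
rewrite cyclic_length_reduced //.
move=> lt; have := leq_mul (leqnn n) lt; rewrite mulnS /n; lia.
Qed.

End Words.

(** * Simple automorphisms recognized by their effect on cyclic length *)

Section SimpleAutomorphisms.
Local Open Scope group_scope.
Set Implicit Arguments.
Unset Strict Implicit.
Variable k : nat.
Implicit Types (l m x y : letter k) (s t r : seq (letter k)).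
Implicit Types (u v w g h z : free_group k).
Implicit Types (phi psi : {multiplicative free_group k -> free_group k}).

(** The permutation commutes with [linv], so applying it letter by letter keeps reduced and
    cyclically reduced words such. *)
Lemma relabeling_cyclic_length psi w :
  relabeling psi -> cyclic_length (psi w) = cyclic_length w.
Proof.
move=> [_ [s psiE]]; have [u [cu [h uE]]] := cyclically_reduced_exists w.
have sV l : s (linv l) = linv (s l).
  have: psi (fg_letter l)^-1 = (psi (fg_letter l))^-1 by rewrite multiplicativeV.
  by rewrite -fg_letterV !psiE -fg_letterV => /(congr1 (@word k)) [].
have psi_seq t : psi (fg_of_seq t) = fg_of_seq (map s t).
  elim: t => [|l t IH]; first by rewrite fg_of_seq0 multiplicative1.
  by rewrite -cat1s map_cat !fg_of_seq_cat gmulfM IH !fg_of_seq1 psiE.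
have sN l m : nocancel (s l) (s m) = nocancel l m.
  by rewrite /nocancel -sV (inj_eq perm_inj).
have red t : reduced t -> reduced (map s t).
  by rewrite /reduced sorted_map; apply: sub_sorted => l m; rewrite /= sN.
have psiw : word (psi u) = map s (word u).
  by rewrite -(fg_of_seq_word u) psi_seq word_fg_of_seq ?fg_of_seq_word ?red ?wordP.
rewrite -(cyclic_length_conj w h) -(cyclic_length_conj _ (psi h)) -multiplicativeJ -uE.
rewrite !cyclic_length_reduced ?psiw ?size_map //.
by move: cu; rewrite !cyclically_reducedE psiw -map_cat; apply: red.
Qed.

Lemma simple_cyclic_length (phi : free_group k -> free_group k) w :
  simple_aut phi -> cyclic_length (phi w) = cyclic_length w.
Proof.
move=> [psi [rel [g ->]]]; rewrite cyclic_length_conj.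
exact: relabeling_cyclic_length.
Qed.

Lemma letter_index_eq l m : l.1 = m.1 -> l = m \/ l = linv m.
Proof. by case: l m => [i [|]] [j [|]] /= ->; auto. Qed.

Lemma nocancel_index l m : l.1 != m.1 -> nocancel l m.
Proof. by apply: contraNneq => ->. Qed.

(* Geometrically: the axes of [x] and [y ^ h] in the Cayley tree are at
   distance [size (word h)]. *)
Lemma cyclic_length_letter_mulJ x y h f s :
    word h = f :: s -> f.1 != y.1 -> (last f s).1 != x.1 ->
  cyclic_length (fg_letter x * fg_letter y ^ h) = (2 * size (word h)).+2.
Proof.
move=> hE fy lx; have rh := wordP h.
(* Only indices are compared, so [rr] and [rl] serve for [x], [y] and also for their inverses; the
   latter, once inverted, handle the half of the word spelling [h^-1]. *)
have rr : forall a, (last f s).1 != a.1 -> reduced (word h ++ [:: a]).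
  move=> a la; have := rh; rewrite hE /reduced /= cats1 rcons_path => ->.
  exact: nocancel_index.
have rl : forall a, f.1 != a.1 -> reduced ([:: a] ++ word h).
  by move=> a fa; have := rh; rewrite hE /reduced /= nocancel_index // eq_sym.
pose s' := rev (map (@linv k) (word h)).
have s'0 : s' != [::] by rewrite /s' hE -size_eq0 size_rev.
have h0 : word h != [::] by rewrite hE.
pose t := x :: s' ++ y :: word h.
have tt : reduced (t ++ t).
  rewrite -cycle_nocancel /= -[X in path _ _ X]cats1 -catA.
  apply: (@reduced_glue _ [:: x] s' ((y :: word h) ++ [:: x])) => //.
    have := inv_reduced (rr (linv x) lx).
    by rewrite map_cat rev_cat /= linvK.
  apply: (@reduced_glue _ s' [:: y] (word h ++ [:: x])) => //.
    have := inv_reduced (rl (linv y) fy).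
    by rewrite map_cat rev_cat /= linvK.
  by apply: (@reduced_glue _ [:: y]) => //; [apply: rl | apply: rr].
have tw : word (fg_of_seq t) = t by rewrite word_fg_of_seq // (reduced_catl tt).
have -> : fg_letter x * fg_letter y ^ h = fg_of_seq t.
  rewrite /t -cat1s -(cat1s y) !fg_of_seq_cat fg_of_seq_rev fg_of_seq_word conjgE.
  by rewrite !mulgA.
rewrite cyclic_length_reduced ?cyclically_reducedE ?tw //= size_cat /=.
by rewrite /s' size_rev size_map addnS addnn -mul2n.
Qed.

(** Membership in the cyclic subgroup of the [i]-th generator, that is, the vertices of its axis in
    the Cayley tree. *)
Definition letters_in (i : 'I_k) w := all (fun l => l.1 == i) (word w).

Lemma letters_inM i u v :
  letters_in i u -> letters_in i v -> letters_in i (u * v).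
Proof.
have [a [b [c [uE vE _ uvE]]]] := cancellation u v.
by rewrite /letters_in uE vE uvE !all_cat => /andP[-> _] /andP[].
Qed.

Lemma letters_inV i u : letters_in i u -> letters_in i u^-1.
Proof.
rewrite /letters_in /= all_rev all_map => /allP iu.
by apply/allP => l /iu.
Qed.

Lemma commute_letter l m : l.1 = m.1 -> commute (fg_letter l) (fg_letter m).
Proof.
move=> /letter_index_eq[-> // |->]; rewrite fg_letterV.
exact/commute_sym/commuteV.
Qed.

Lemma commute_letters_in x z : letters_in x.1 z -> commute (fg_letter x) z.
Proof.
rewrite -[in commute _ _](fg_of_seq_word z) /letters_in.
elim: (word z) => [_|l s IH /= /andP[/eqP lx /IH]].
  by rewrite fg_of_seq0; apply: commute1.
rewrite -cat1s fg_of_seq_cat; apply: commuteM.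
by rewrite fg_of_seq1; apply: commute_letter.
Qed.

(** The axes of [x] and [y ^ h] meet, with [z^-1] a common vertex. Leading letters of [h] with the
    index of [y] commute with [y] and are dropped; trailing ones with the index of [x] commute with
    [x] and go into [z]. A nonempty [h] of neither kind would give length at least 4. *)
Lemma short_letter_mulJ x y h :
    (cyclic_length (fg_letter x * fg_letter y ^ h)%g <= 2)%N ->
  exists z, letters_in x.1 z /\ fg_letter y ^ h = fg_letter y ^ z.
Proof.
move: {2}(size _) (leqnn (size (word h))) => n.
elim: n h => [|n IH] h hn hc.
  by exists h; rewrite /letters_in; case: (word h) hn.
case hE: (word h) hn => [|f s] hn; first by exists h; rewrite /letters_in hE.
have [fy|fy] := eqVneq f.1 y.1.
  have yh : fg_letter y ^ h = fg_letter y ^ (fg_of_seq s).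
    rewrite -(fg_of_seq_word h) hE -cat1s fg_of_seq_cat fg_of_seq1 conjgM.
    by congr (_ ^ _); apply/conjg_fixP/commgP/commute_sym/commute_letter.
  rewrite yh; apply: IH; last by rewrite -yh.
  by apply: leq_trans (size_foldr_push _ _) _; rewrite addn0 -ltnS.
have [lx|lx] := eqVneq (last f s).1 x.1; last first.
  by move: hc; rewrite (cyclic_length_letter_mulJ hE) // hE.
pose h' := fg_of_seq (belast f s); pose e := fg_letter (last f s).
have he : h = h' * e.
  by rewrite -(fg_of_seq_word h) hE lastI -cats1 fg_of_seq_cat fg_of_seq1.
have xe : fg_letter x ^ e = fg_letter x.
  by apply/conjg_fixP/commgP/commute_letter.
have [||z [zx yz]] := IH h'.
- apply: leq_trans (size_foldr_push _ _) _; rewrite addn0 size_belast.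
  by move: hn; rewrite ltnS.
- by rewrite -(cyclic_length_conj _ e) conjMg xe -conjgM -he.
- exists (z * e); split; last by rewrite he !conjgM yz.
  by apply: letters_inM => //; rewrite /letters_in /= lx eqxx.
Qed.

(** A morphism to Z/2. Being invariant under conjugation and inversion, it shows that distinct
    generators are not conjugate, even up to inversion. *)
Definition letter_parity (i : 'I_k) w :=
  odd (count (fun l => l.1 == i) (word w)).

Lemma letter_parityM i u v :
  letter_parity i (u * v) = letter_parity i u (+) letter_parity i v.
Proof.
have [a [b [c [uE vE _ uvE]]]] := cancellation u v.
rewrite /letter_parity uE vE uvE !count_cat count_rev count_map.
rewrite (@eq_count _ (preim (@linv k) _) (fun l => l.1 == i)) // !oddD.
by rewrite addbA addbK.
Qed.

Lemma letter_parityJ i u g : letter_parity i (u ^ g) = letter_parity i u.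
Proof.
have p1 : letter_parity i (g^-1 * g) = false by rewrite mulVg.
move: p1; rewrite conjgE !letter_parityM.
by case: (letter_parity i g^-1) (letter_parity i g) (letter_parity i u) => [] [] [].
Qed.

Lemma letter_parityV i u : letter_parity i u^-1 = letter_parity i u.
Proof.
have: letter_parity i (u^-1 * u) = false by rewrite mulVg.
by rewrite letter_parityM; case: (letter_parity _ _) (letter_parity _ _) => [] [].
Qed.

(* Two letters of distinct index span distinct axes, so the axes of the
   [phi a_i], which pairwise meet since [phi (a_i a_j)] has length at most 2,
   pairwise meet in a single vertex; the vertices on the axis of [phi a_1]
   coincide, and conjugating this common vertex to 1 gives a relabeling. *)
Lemma nonexpanding_simple phi : (2 <= k)%N -> bijective phi ->
  (forall w, (cyclic_length (phi w) <= cyclic_length w)%N) -> simple_aut phi.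
Proof.
move=> k2 phi_bij phi_le; have phi_inj := bij_inj phi_bij.
pose a i : free_group k := fg_letter (i, true).
have /choice[xh xhE] i : exists p : letter k * free_group k,
    phi (a i) = fg_letter p.1 ^ p.2.
  have := phi_le (a i); rewrite (@cyclic_length_reduced _ (a i)); last first.
    by rewrite cyclically_reducedE /= /reduced /= /nocancel xpair_eqE andbF.
  have a1 : phi (a i) != 1.
    by rewrite -(multiplicative1 phi) (inj_eq phi_inj) -word_eq0.
  rewrite leq_eqVlt ltnS leqn0 cyclic_length_eq0 (negPf a1) orbF.
  have [u [cu [g uE]]] := cyclically_reduced_exists (phi (a i)).
  rewrite -(cyclic_length_conj _ g) -uE cyclic_length_reduced //= => u1.
  case wu: (word u) u1 => [|l []] // _; exists (l, g^-1) => /=.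
  have -> : fg_letter l = u by apply: word_inj.
  by rewrite uE conjgK.
pose x i := (xh i).1; pose h i := (xh i).2.
have phiE i : phi (a i) = fg_letter (x i) ^ h i := xhE i.
(* Equal indices would make [phi (a i)] conjugate to [phi (a j)] or its inverse, hence [a i]
   conjugate to [a j] or its inverse, which parity excludes unless [i = j]. *)
have x_inj i j : (x i).1 = (x j).1 -> i = j.
  move=> xij; have [phi' phiK phiK'] := phi_bij.
  suff : letter_parity i (a j) = letter_parity i (a i).
    by rewrite /letter_parity /= !addn0 eqxx; case: (eqVneq j i) => [->|].
  pose g := phi' ((h j)^-1 * h i).
  have phig u : phi (u ^ g) = phi u ^ ((h j)^-1 * h i) by rewrite multiplicativeJ phiK'.
  have [xE|xE] := letter_index_eq xij.
    rewrite -(letter_parityJ i (a j) g); congr (letter_parity _ _).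
    by apply: phi_inj; rewrite phig !phiE -conjgM mulVKg xE.
  rewrite -(letter_parityV i (a j)) -(letter_parityJ i _ g).
  congr (letter_parity _ _); apply: phi_inj.
  by rewrite phig multiplicativeV !phiE -conjVg -fg_letterV -conjgM mulVKg xE.
have phi_pair i j :
    (cyclic_length (fg_letter (x i) * fg_letter (x j) ^ (h j * (h i)^-1))%g <= 2)%N.
  rewrite -(cyclic_length_conj _ (h i)) conjMg -conjgM mulgVK -!phiE -gmulfM.
  apply: leq_trans (phi_le _) _; apply: leq_trans (cyclic_length_le _) _.
  exact: Defs.size_mul.
pose i0 : 'I_k := Ordinal (ltnW k2); pose j0 : 'I_k := Ordinal k2.
(* [z] records a common vertex of the axes of [phi (a i0)] and [phi (a j0)]; [phiz] then says that
   all the other axes pass through it. *)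
have [z [zx zE]] := short_letter_mulJ (phi_pair i0 j0).
have phiz j : phi (a j) = fg_letter (x j) ^ (z * h i0).
  have [->|ji] := eqVneq j i0.
    rewrite phiE conjgM; congr (_ ^ _); apply/esym/conjg_fixP/commgP.
    exact: commute_letters_in.
  have [z' [zx' zE']] := short_letter_mulJ (phi_pair i0 j).
  have hz : fg_letter (x j) ^ h j = fg_letter (x j) ^ (z' * h i0).
    by rewrite [RHS]conjgM -zE' -conjgM mulgVK.
  have hz0 : fg_letter (x j0) ^ h j0 = fg_letter (x j0) ^ (z * h i0).
    by rewrite [RHS]conjgM -zE -conjgM mulgVK.
  rewrite phiE; have [->|jj] := eqVneq j j0; first exact: hz0.
  rewrite hz.
  (* The axes of [phi (a j0)] and [phi (a j)] reach that of [phi (a i0)] at points differing by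
     [z' * z^-1]. If this were not 1, the path between them would force [phi (a j0 * a j)] to have
     length at least 4. *)
  have : (cyclic_length (fg_letter (x j0) * fg_letter (x j) ^ (z' * z^-1))%g <= 2)%N.
    rewrite -(cyclic_length_conj _ (z * h i0)) conjMg -conjgM -(mulgA z') mulKg.
    rewrite -hz -hz0 -!phiE -gmulfM.
    apply: leq_trans (phi_le _) _; apply: leq_trans (cyclic_length_le _) _.
    exact: Defs.size_mul.
  have : letters_in (x i0).1 (z' * z^-1).
    by apply: letters_inM => //; apply: letters_inV.
  case zz: (word (z' * z^-1)) => [|f s].
    move/eqP: zz; rewrite word_eq0 => /eqP zz _ _.
    by rewrite -[z'](mulgVK z) zz mul1g.
  rewrite /letters_in zz => /allP in0.
  have f0 l : l \in f :: s -> l.1 = (x i0).1 by move/in0/eqP.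
  rewrite (cyclic_length_letter_mulJ zz) ?zz //.
  - by rewrite f0 ?mem_head //; apply: contra_neq ji => /x_inj.
  - by rewrite f0 ?mem_last //; apply/eqP => /x_inj.
pose g := z * h i0; pose f w := phi w ^ g^-1.
have fM : {morph f : u v / u * v} by move=> u v; rewrite /f gmulfM conjMg.
pose psi : {multiplicative free_group k -> free_group k} :=
  HB.pack f (isMultiplicative.Build _ _ f fM).
have psi_inj : injective psi by move=> u v /conjg_inj /phi_inj.
pose y l : letter k := if l.2 then x l.1 else linv (x l.1).
have psiE l : psi (fg_letter l) = fg_letter (y l).
  case: l => i []; rewrite /psi /f /y /=; first by rewrite phiz conjgK.
  rewrite (_ : (i, false) = linv (i, true)) // !fg_letterV multiplicativeV conjVg.
  by rewrite phiz conjgK.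
have y_inj : injective y.
  move=> l m ylm; have /psi_inj/(congr1 (@word k))[] // :
    psi (fg_letter l) = psi (fg_letter m) by rewrite !psiE ylm.
exists psi; split; last by exists g => w; rewrite /= /f conjgKV.
split; last by exists (perm y_inj) => l; rewrite permE.
have [phi' phiK phiK'] := phi_bij.
exists (fun w => phi' (w ^ g)) => w; first by rewrite /= /f conjgKV.
by rewrite /= /f phiK' conjgK.
Qed.

(** The inverse of [phi] is nonexpanding, hence simple, hence preserves cyclic length. So does
    [phi], which is therefore nonexpanding as well. *)
Lemma nonshrinking_simple phi : (2 <= k)%N -> bijective phi ->
  (forall w, (cyclic_length w <= cyclic_length (phi w))%N) -> simple_aut phi.
Proof.
move=> k2 phi_bij phi_ge; have [f phiK phiK'] := phi_bij.
pose theta : {multiplicative free_group k -> free_group k} :=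
  HB.pack f (isMultiplicative.Build _ _ f (can2_gmulfM phiK phiK')).
have theta_simple : simple_aut theta.
  apply: nonexpanding_simple => // [|w]; first by exists phi.
  by have := phi_ge (theta w); rewrite phiK'.
apply: nonexpanding_simple => // w.
by have /= := simple_cyclic_length (phi w) theta_simple; rewrite phiK => <-.
Qed.

End SimpleAutomorphisms.

(** * Stable cancellation between powers of independent elements *)

Section Independence.
Local Open Scope group_scope.
Set Implicit Arguments.
Unset Strict Implicit.
Variable k : nat.
Implicit Types (l x y : letter k) (s t r : seq (letter k)).
Implicit Types (u v w g h z : free_group k).

Lemma reduced_nseq_cat s r n :
  s != [::] -> reduced (s ++ s) -> reduced (s ++ r) ->
  reduced (flatten (nseq n s) ++ r).
Proof.
move=> s0 ss sr; suff : reduced (s ++ flatten (nseq n s) ++ r) by apply: reduced_catr.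
by elim: n => [|n IH] //=; rewrite -catA; apply: reduced_glue.
Qed.

Lemma reduced_cat_nseq s r n :
  s != [::] -> reduced (s ++ s) -> reduced (r ++ s) ->
  reduced (r ++ flatten (nseq n s)).
Proof.
move=> s0 ss rs; have ssn : reduced (s ++ flatten (nseq n s)).
  exact: (@reduced_nseq _ s n.+1).
have := reduced_glue s0 rs ssn; case: n ssn => [|n] ssn.
  by move=> _; rewrite cats0; apply: reduced_catl rs.
by move=> _; apply: reduced_glue => //; exact: (@reduced_nseq _ s n.+1).
Qed.

(** If a letter of [u ^+ n] survives, the product begins with a nonempty prefix of [u ^+ n], which
    may be preceded by [u]; otherwise [h] absorbs all of [u ^+ n] and the sizes subtract. *)
Lemma expg_mul_left u h n : cyclically_reduced u ->
  (u ^+ n * h != 1 /\ reduced (word u ++ word (u ^+ n * h))) \/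
  (size (word (u ^+ n * h)%g) + n * size (word u))%N = size (word h).
Proof.
move=> cu; have [a [b [c [unE hE ab uhE]]]] := cancellation (u ^+ n) h.
have [a0|a0] := eqVneq a [::].
  right; rewrite -Defs.size_exp // uhE unE hE a0 /= size_cat size_rev size_map.
  exact: addnC.
left; rewrite -word_eq0 uhE; split; first by case: (a) a0.
apply: reduced_glue => //; apply: (@reduced_catl _ _ c).
rewrite -catA -unE word_exp //; apply: (@reduced_nseq _ _ n.+1).
by rewrite -cyclically_reducedE.
Qed.

Lemma expg_mul_right v h n : cyclically_reduced v ->
  reduced (word (h * v ^+ n) ++ word v) \/
  (size (word (h * v ^+ n)%g) + n * size (word v))%N = size (word h).
Proof.
move=> cv; have [a [b [c [hE vnE ab hvE]]]] := cancellation h (v ^+ n).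
have [b0|b0] := eqVneq b [::].
  right; rewrite -Defs.size_exp // hvE vnE hE b0 !cats0 !size_cat size_rev.
  by rewrite size_map.
left; rewrite hvE -catA; apply: reduced_glue => //.
apply: (@reduced_catr _ (rev (map (@linv k) c))); rewrite catA -vnE word_exp //.
rewrite (_ : _ ++ _ = flatten (nseq (n + 1) (word v))); last first.
  by rewrite nseqD flatten_cat /= cats0.
by apply: reduced_nseq; rewrite -cyclically_reducedE.
Qed.

(** Exponents are natural numbers, hence the two signs. Allowing one of [p], [q] to vanish makes [u]
    and [v] nontrivial too. *)
Definition independent u v := forall p q g,
  u ^+ p = (v ^+ q) ^ g \/ u ^+ p = (v ^- q) ^ g -> p = 0%N /\ q = 0%N.

Lemma independent_sym u v : independent u v -> independent v u.
Proof.
move=> uv p q g vu; suff [] : q = 0%N /\ p = 0%N by [].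
apply: (uv _ _ g^-1); case: vu => ->; rewrite conjgK; first by left.
by right; rewrite conjVg conjgK invgK.
Qed.

Lemma independentJ u v a b : independent u v -> independent (u ^ a) (v ^ b).
Proof.
move=> uv p q g h; apply: (uv _ _ (b * g * a^-1)); move: h.
rewrite -!conjXg -conjVg => h; rewrite !conjgM; case: h => <-; rewrite conjgK; auto.
Qed.

Lemma independent_neq1 u v : independent u v -> u != 1.
Proof.
move=> uv; apply/eqP => u1.
have [] // := uv 1%N 0%N 1; left.
by rewrite u1 expg1 conj1g.
Qed.

(** Removing common powers leaves a power of [u] equal to a conjugate of a power of [v] or its
    inverse, so both exponents vanish. *)
Lemma independent_inj u v g i j i' j' : independent u v ->
  u ^+ i * g * v ^+ j = u ^+ i' * g * v ^+ j' -> j = j'.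
Proof.
move=> uv; wlog ii' : i j i' j' / (i <= i')%N => [th|].
  case: (leqP i i') => [|/ltnW] ii' e; first exact: th e.
  by apply/esym; apply: th ii' _.
rewrite -(subnKC ii'); move: (i' - i)%N => d.
rewrite expgD -!mulgA => /mulgI; rewrite !mulgA.
case: (leqP j' j) => [jj|/ltnW jj].
  rewrite -{1}(subnK jj) expgD mulgA => /mulIg e.
  have [_ e0] : d = 0%N /\ (j - j')%N = 0%N.
    by apply: (uv _ _ g^-1); left; rewrite conjgE invgK mulgA e mulgK.
  by apply/eqP; rewrite eqn_leq jj -subn_eq0 e0.
rewrite -{1}(subnK jj) expgD mulgA -{1}(mul1g (v ^+ j)) mulgA mulg1 => /mulIg e.
have [_ e0] : d = 0%N /\ (j' - j)%N = 0%N.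
  by apply: (uv _ _ g^-1); right; rewrite conjgE invgK mulgA [X in X * _ * _]e !mulgK.
by apply/eqP; rewrite eqn_leq jj -subn_eq0 e0.
Qed.

Lemma not_injective_bounded (f : nat -> free_group k) B :
  (forall n, size (word (f n)) <= B)%N -> exists m n : nat, m != n /\ f m = f n.
Proof.
move=> fB; pose N := #|{bseq B of letter k}|.
pose F (i : 'I_N.+1) : {bseq B of letter k} := Bseq (fB i).
have /injectivePn[i [j ij FE]] : ~~ injectiveb F.
  by apply/injectiveP => /leq_card; rewrite card_ord ltnn.
exists i, j; split; first by [].
by apply: word_inj; move/(congr1 val): FE.
Qed.

(* Otherwise either all of [v ^+ j] or almost all of [u ^+ i] would cancel, for
   every j and the least i such that some letter of [u ^+ i] survives; the two
   estimates bound the length of [u ^+ i * g * v ^+ j] independently of j. *)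
Lemma stable_middle u v g :
    cyclically_reduced u -> cyclically_reduced v -> independent u v ->
  exists i j, let r := u ^+ i * g * v ^+ j in
    [/\ r != 1, reduced (word u ++ word r) & reduced (word r ++ word v)].
Proof.
move=> cu cv uv; apply: contrapT => none.
have u0 : (0 < size (word u))%N.
  by rewrite lt0n size_eq0 word_eq0 (independent_neq1 uv).
pose B := (size (word g) + size (word u))%N.
(* A bound uniform in [j] would leave finitely many values for these products, whereas they are
   distinct for distinct [j]. *)
suff /choice[f fB] j : exists i, (size (word (u ^+ i * g * v ^+ j)%g) <= B)%N.
  have [m [n [mn /(independent_inj uv) /eqP]]] := not_injective_bounded fB.
  by rewrite (negPf mn).
pose A i := (u ^+ i * (g * v ^+ j) != 1) &&
  reduced (word u ++ word (u ^+ i * (g * v ^+ j))).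
have exA : exists i, A i.
  exists (size (word (g * v ^+ j))).+1; apply/andP.
  have [//|] := expg_mul_left (g * v ^+ j) (size (word (g * v ^+ j))).+1 cu.
  by move=> e; exfalso; nia.
have [i Ai imin] := ex_minnP exA.
have Bi : (size (word (u ^+ i * g * v ^+ j)%g) + j * size (word v) =
    size (word (u ^+ i * g)%g))%N.
  have [rB|//] := expg_mul_right (u ^+ i * g) j cv.
  case: none; exists i, j; case/andP: Ai; rewrite mulgA => r1 rA.
  by split.
exists i; rewrite /B.
have ug n : (size (word (u ^+ n * g)%g) <= n * size (word u) + size (word g))%N.
  by rewrite -Defs.size_exp //; apply: Defs.size_mul.
case: i Ai imin Bi => [|i] Ai imin Bi; first by have := ug 0%N; lia.
have Ci : (size (word (u ^+ i * (g * v ^+ j))%g) + i * size (word u) =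
    size (word (g * v ^+ j)%g))%N.
  have [/andP /imin|//] := expg_mul_left (g * v ^+ j) i cu.
  by rewrite ltnn.
have gv : (size (word (g * v ^+ j)%g) <= size (word g) + j * size (word v))%N.
  by rewrite -Defs.size_exp //; apply: Defs.size_mul.
have uw : (size (word (u ^+ i.+1 * g * v ^+ j)%g) <=
    size (word u) + size (word (u ^+ i * (g * v ^+ j))%g))%N.
  by rewrite expgS -!mulgA; apply: Defs.size_mul.
(* With X the size to bound, [Bi] gives X <= (i+1)|u| + |g| - j|v|, and [Ci] gives X <= |u| + |g| +
   j|v| - i|u|. The sum is 2X <= 2B. *)
have := ug i.+1; lia.
Qed.

(** With stable middles [r] and [s] at the two kinds of junction, the product is conjugate to a
    cyclically reduced concatenation of blocks. [K] may depend on [N], but any large [N] works, so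
    two pairs of elements can share one [N]. *)
Lemma cyclic_length_prod_exp u v : independent u v ->
  exists N0, forall N, (N0 <= N)%N -> exists K, forall l : seq (nat * nat),
    l != [::] ->
    cyclic_length (\prod_(p <- l) (u ^+ (p.1 + N) * v ^+ (p.2 + N))) =
    (\sum_(p <- l) (p.1 * cyclic_length u + p.2 * cyclic_length v + K))%N.
Proof.
move=> uv.
have [u0 [cu [a uE]]] := cyclically_reduced_exists u.
have [v0 [cv [b vE]]] := cyclically_reduced_exists v.
have uv0 : independent u0 v0 by rewrite uE vE; apply: independentJ.
have vu0 := independent_sym uv0.
have lu : cyclic_length u = size (word u0).
  by apply: cyclic_lengthP => //; exists a.
have lv : cyclic_length v = size (word v0).
  by apply: cyclic_lengthP => //; exists b.
pose g := a^-1 * b.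
have [i [j [r0 ur rv]]] := stable_middle g cu cv uv0.
have [j' [i' [s0 vs su]]] := stable_middle g^-1 cv cu vu0.
move: (independent_neq1 uv0) (independent_neq1 vu0); rewrite -!word_eq0 => wu0 wv0.
rewrite !cyclically_reducedE in cu cv.
set r := _ * _ in r0 ur rv; set s := _ * _ in s0 vs su; rewrite -!word_eq0 in r0 s0.
exists (i + i' + j + j').+1 => N hN.
(* Of the [N] extra copies of [u0], [i] go into [r] and [i'] into [s]; at least one is left, so that
   the gluing overlaps are nonempty. The same holds for [v0]. *)
have [e Ne] : exists e, N = (i' + e.+1 + i)%N.
  exists (N - (i + i').+1)%N; clear -hN; lia.
have [f Nf] : exists f, N = (j + f.+1 + j')%N.
  exists (N - (j + j').+1)%N; clear -hN; lia.
exists (e.+1 * size (word u0) + size (word r) + f.+1 * size (word v0) +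
  size (word s))%N => l l0.
pose U := word u0; pose V := word v0.
pose bw (p : nat * nat) := flatten (nseq (p.1 + e).+1 U) ++ word r ++
  flatten (nseq (p.2 + f).+1 V) ++ word s.
have nseq0 n t : t != [::] -> flatten (nseq n.+1 t) != [::] :> seq (letter k).
  by case: t.
have fgX w n : fg_of_seq (flatten (nseq n (word w))) = w ^+ n.
  elim: n => [|n IH]; first exact: fg_of_seq0.
  by rewrite expgS /= fg_of_seq_cat IH fg_of_seq_word.
have bwU p : reduced (bw p ++ U).
  rewrite /bw; set X := flatten _; set Y := flatten _.
  have Xr : reduced (X ++ word r) by apply: reduced_nseq_cat.
  have rY : reduced (word r ++ Y) by apply: reduced_cat_nseq.
  have Ys : reduced (Y ++ word s) by apply: reduced_nseq_cat.
  have Y0 : Y != [::] by apply: nseq0.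
  clearbody X Y; rewrite -!catA; apply: reduced_glue => //.
  by apply: reduced_glue => //; apply: reduced_glue.
have bwF p : fg_of_seq (bw p) =
    u0 ^+ (p.1 + e).+1 * (r * (v0 ^+ (p.2 + f).+1 * s)).
  rewrite /bw -!fgX -/U -/V; set X := flatten _; set Y := flatten _.
  by clearbody X Y; rewrite !fg_of_seq_cat !fg_of_seq_word.
have bwE p : exists q, bw p = U ++ q.
  by eexists; rewrite /bw (_ : nseq _.+1 U = U :: nseq (p.1 + e) U) // -catA.
pose t := flatten (map bw l).
(* The prefix [U] is carried along because it is the overlap used to glue the next block, and
   finally to close the word up cyclically. *)
have [[t' tE] tU] : (exists t', t = U ++ t') /\ reduced (t ++ U).
  rewrite /t; elim: (l) l0 => // p l' IH _; have [q qE] := bwE p; split.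
    by exists (q ++ flatten (map bw l')); rewrite /= qE catA.
  have flat1 : flatten (map bw [:: p]) = bw p by apply: cats0.
  case: l' IH => [_|p' l' /(_ isT)]; first by rewrite flat1.
  rewrite -(cat1s p) map_cat flatten_cat; move: (flatten (map bw (p' :: l'))) => w.
  move=> [[w' wE] wU]; rewrite wE in wU *; rewrite flat1.
  rewrite -(catA (bw p)) -(catA U); apply: reduced_glue => //.
  by rewrite catA.
have tt : reduced (t ++ t).
  rewrite {2}tE; apply: reduced_glue => //; rewrite -tE; exact: reduced_catl tU.
have tw : word (fg_of_seq t) = t by rewrite word_fg_of_seq // (reduced_catl tt).
(* Each factor is its block conjugated by the same element, since [s] ends with the factor
   [u0 ^+ i'] that is moved to the front. *)
have -> : \prod_(p <- l) (u ^+ (p.1 + N) * v ^+ (p.2 + N)) =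
    fg_of_seq t ^ (a * u0 ^+ i')^-1.
  rewrite /t; elim: (l) => [|p l' IH]; first by rewrite big_nil fg_of_seq0 conj1g.
  rewrite big_cons IH -[flatten (map bw (p :: l'))]/(bw p ++ flatten (map bw l')).
  rewrite fg_of_seq_cat conjMg; congr (_ * _).
  rewrite bwF.
  have -> : u = u0 ^ a^-1 by rewrite uE conjgK.
  have -> : v = v0 ^ b^-1 by rewrite vE conjgK.
  rewrite -!conjXg !conjgE !invgK invMg.
  have -> : (p.1 + N = i' + (p.1 + e).+1 + i)%N by clear -Ne; lia.
  have -> : (p.2 + N = j + (p.2 + f).+1 + j')%N by clear -Nf; lia.
  move: (p.1 + e).+1 (p.2 + f).+1 => m n.
  by rewrite !expgD /r /s /g invMg !invgK !mulgA !mulgK.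
rewrite cyclic_length_conj cyclic_length_reduced ?cyclically_reducedE ?tw // /t.
have szX n (q : seq (letter k)) : size (flatten (nseq n q)) = (n * size q)%N.
  by elim: n => //= n IH; rewrite size_cat IH mulSn.
have bwS p : size (bw p) = (p.1 * size U + p.2 * size V +
    (e.+1 * size U + size (word r) + f.+1 * size V + size (word s)))%N.
  rewrite /bw; set X := flatten _; set Y := flatten _.
  have sX : size X = ((p.1 + e.+1) * size U)%N by rewrite addnS -szX.
  have sY : size Y = ((p.2 + f.+1) * size V)%N by rewrite addnS -szX.
  clearbody X Y; rewrite !size_cat sX sY !mulnDl.
  move: (e.+1 * _)%N (f.+1 * _)%N (p.1 * _)%N (p.2 * _)%N => *; clear; lia.
elim: (l) => [|p l' IH]; first by rewrite big_nil.
rewrite big_cons -[flatten (map bw (p :: l'))]/(bw p ++ flatten (map bw l')).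
by rewrite size_cat IH bwS lu lv.
Qed.

End Independence.

Local Open Scope ring_scope.

(** * Density of ratios near 1 *)

Section Distortion.
Set Implicit Arguments.
Unset Strict Implicit.

(* For r near 1, take m = floor (n B / A) where A = r x - x' > 0 and
   B = y' - r y > 0: then (m x' + n y' + K') - r (m x + n y + K) is bounded
   independently of n. *)
Lemma ratios_dense_near1 (R : realType) (x x' y y' K K' : nat) :
    (x' < x)%N -> (0 < y < y')%N ->
  exists2 d : R, 0 < d & forall r : R, `|1 - r| < d -> forall e : R, 0 < e ->
    exists m n : nat, (0 < n)%N /\
      `|r - (m * x' + n * y' + K')%:R / (m * x + n * y + K)%:R| < e.
Proof.
move=> xx /andP[y0 yy].
have xR : x'%:R + 1 <= x%:R :> R by rewrite natr1 ler_nat.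
have yR : y%:R + 1 <= y'%:R :> R by rewrite natr1 ler_nat.
have y1 : 1 <= y%:R :> R by rewrite ler1n.
have x'0 : 0 <= x'%:R :> R by [].
(* Since x - x' and y' - y are at least 1, |1 - r|x < 1 and |1 - r|y < 1 suffice for [A] and [B] to
   be positive. *)
exists (Num.min x%:R^-1 y%:R^-1).
  by rewrite lt_min !invr_gt0 !ltr0n y0 (leq_trans _ xx).
move=> r; rewrite lt_min => /andP[rx ry] e e0.
have {}rx : `|1 - r| * x%:R < 1.
  by rewrite -ltr_pdivlMr ?div1r // ltr0n (leq_trans _ xx).
have {}ry : `|1 - r| * y%:R < 1 by rewrite -ltr_pdivlMr ?div1r // ltr0n.
pose A := r * x%:R - x'%:R; pose B := y'%:R - r * y%:R.
have A0 : 0 < A.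
  have : (1 - r) * x%:R <= `|1 - r| * x%:R by rewrite ler_wpM2r // ler_norm.
  by rewrite /A; lra.
have B0 : 0 < B.
  have : - (1 - r) * y%:R <= `|1 - r| * y%:R.
    by rewrite ler_wpM2r // -normrN ler_norm.
  by rewrite /B; lra.
pose C := A + `|K'%:R - r * K%:R|.
have C0 : 0 < C by rewrite ltr_pwDl.
(* [C] will bound the numerator of the error, whose denominator is at least [n]; this choice makes C
   / n < e. *)
pose n := (Num.truncn (C / e)).+1.
have Cn : C < n%:R * e by rewrite -ltr_pdivrMr // truncnS_gt.
have nBA : 0 <= n%:R * B / A by rewrite divr_ge0 ?mulr_ge0 // ltW.
have [m /andP[mle mlt]] : exists m, (m%:R : R) <= n%:R * B / A < m.+1%:R.
  by exists (Num.truncn (n%:R * B / A)); apply: truncn_itv.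
exists m, n; split=> //.
rewrite ler_pdivlMr // in mle; rewrite ltr_pdivrMr // -natr1 in mlt.
have n0 : (0 < n)%N by [].
clearbody n; set p := (_ + K')%N; set q := (_ + K)%N.
have nq : n%:R <= q%:R :> R.
  rewrite ler_nat /q; apply: leq_trans (leq_addr _ _); apply: leq_trans (leq_addl _ _).
  by rewrite leq_pmulr.
have q0 : 0 < q%:R :> R by apply: lt_le_trans nq; rewrite ltr0n.
have -> : r - p%:R / q%:R = (r * q%:R - p%:R) / q%:R by field; rewrite gt_eqF.
rewrite normrM normfV (gtr0_norm q0) ltr_pdivrMr //.
apply: (@le_lt_trans _ _ C); last first.
  by apply: lt_le_trans Cn _; rewrite mulrC ler_wpM2l // ltW.
have -> : r * q%:R - p%:R = (m%:R * A - n%:R * B) - (K'%:R - r * K%:R).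
  by rewrite /q /p /A /B !natrD !natrM; ring.
apply: le_trans (ler_normB _ _) _; rewrite lerD2r ler_norml.
by rewrite mulrDl mul1r in mlt; apply/andP; split; lra.
Qed.

(** * Consequences of having one shortened and one lengthened element *)

Section TwoDirections.
Variables (k : nat) (phi : {multiplicative free_group k -> free_group k}).
Variables (phi_bij : bijective phi) (u v : free_group k).
Hypothesis shrink_u : (cyclic_length (phi u) < cyclic_length u)%N.
Hypothesis expand_v : (cyclic_length v < cyclic_length (phi v))%N.

Let v_gt0 : (0 < cyclic_length v)%N.
Proof.
rewrite cyclic_length_gt0; apply: contraTneq expand_v => ->.
by rewrite multiplicative1 ltnn.
Qed.

(** A relation gives p||u|| = q||v|| and p||phi u|| = q||phi v||. Since [phi] shortens [u] and
    lengthens [v], both can hold only for p = q = 0. *)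
Lemma distortion_independent : independent u v.
Proof.
move=> p q g uv.
have e1 : (p * cyclic_length u = q * cyclic_length v)%N.
  rewrite -!cyclic_lengthX; case: uv => ->; rewrite cyclic_length_conj //.
  exact: cyclic_lengthV.
have e2 : (p * cyclic_length (phi u) = q * cyclic_length (phi v))%N.
  rewrite -!cyclic_lengthX -!multiplicativeX; case: uv => ->.
    by rewrite multiplicativeJ cyclic_length_conj.
  by rewrite multiplicativeJ cyclic_length_conj multiplicativeV cyclic_lengthV.
move: v_gt0 shrink_u expand_v e1 e2.
move: (cyclic_length _) (cyclic_length _) (cyclic_length _) (cyclic_length _).
move=> a b c d; nia.
Qed.

Lemma independent_image : independent (phi u) (phi v).
Proof.
have [f phiK phiK'] := phi_bij => p q g uv.
apply: (distortion_independent (g := f g)); case: uv => uv; [left|right];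
  apply: (bij_inj phi_bij);
  by rewrite multiplicativeJ ?multiplicativeV !multiplicativeX phiK'.
Qed.

Lemma cyclic_length_two_directions : exists N K K' : nat,
  forall l : seq (nat * nat), l != [::] ->
    let w := (\prod_(p <- l) (u ^+ (p.1 + N) * v ^+ (p.2 + N)))%g in
    cyclic_length w =
      (\sum_(p <- l) (p.1 * cyclic_length u + p.2 * cyclic_length v + K))%N /\
    cyclic_length (phi w) =
      (\sum_(p <- l) (p.1 * cyclic_length (phi u) +
                      p.2 * cyclic_length (phi v) + K'))%N.
Proof.
have [N1 H1] := cyclic_length_prod_exp distortion_independent.
have [N2 H2] := cyclic_length_prod_exp independent_image.
have [K HK] := H1 (maxn N1 N2) (leq_maxl _ _).
have [K' HK'] := H2 (maxn N1 N2) (leq_maxr _ _).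
exists (maxn N1 N2), K, K' => l l0; split; first exact: HK.
rewrite -HK' // (big_morph phi (gmulfM (s := phi)) (multiplicative1 phi)).
congr cyclic_length; apply: eq_bigr => p _.
by rewrite gmulfM !multiplicativeX.
Qed.

Lemma cyclic_length_preserved :
  exists w : free_group k, w <> 1%g /\ cyclic_length (phi w) = cyclic_length w.
Proof.
have [N [K [K' H]]] := cyclic_length_two_directions.
move: shrink_u expand_v H; move: (cyclic_length u) (cyclic_length v).
move: (cyclic_length (phi u)) (cyclic_length (phi v)) => x' y' x y xx yy H.
(* These exponents outweigh the constants: n(y' - y) > K - K' and m(x - x') > K' - K. *)
pose n := K.+1; pose m := K'.+1.
pose a := (n * y + K)%N; pose a' := (n * y' + K')%N.
pose b := (m * x + K)%N; pose b' := (m * x' + K')%N.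
have aa : (a < a')%N by rewrite /a /a' /n; nia.
have bb : (b' < b)%N by rewrite /b /b' /m; nia.
(* Blocks lengthened by a' - a occur b - b' times, blocks shortened by b - b' occur a' - a times,
   and the changes cancel. *)
pose l := nseq (b - b') (0%N, n) ++ nseq (a' - a) (m, 0%N).
have l0 : l != [::] by rewrite -size_eq0 size_cat !size_nseq; lia.
have [/=] := H l l0; set w := (\prod_(p <- l) _)%g => Hw Hw'.
have sumE (f : nat * nat -> nat) : (\sum_(p <- l) f p =
    (b - b') * f (0, n) + (a' - a) * f (m, 0))%N.
  by rewrite big_cat /= !big_nseq !iter_addn_0 ![(f _ * _)%N]mulnC.
rewrite sumE /= !mul0n addn0 add0n -/a -/b in Hw.
rewrite sumE /= !mul0n addn0 add0n -/a' -/b' in Hw'.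
exists w; split; last by rewrite Hw Hw'; nia.
apply/eqP; rewrite -cyclic_length_gt0 Hw; apply: ltn_addl.
by rewrite muln_gt0 subn_gt0 aa; apply: leq_ltn_trans bb.
Qed.

Lemma interior_distortion_spectrum (R : realType) :
  interior (closure [set (ratr q : R) | q in distortion_spectrum phi]) 1.
Proof.
have [N [K [K' H]]] := cyclic_length_two_directions.
have vv : (0 < cyclic_length v < cyclic_length (phi v))%N.
  by rewrite v_gt0 expand_v.
have [d d0 Hd] := ratios_dense_near1 R K K' shrink_u vv.
apply/nbhs_ballP; exists d => //= r; rewrite /ball /= => /Hd {}Hd.
move=> B /nbhs_ballP[e /= e0 eB].
have [m [n [n0 mn]]] := Hd e e0.
(* One block suffices: the witness is u^(m+N) v^(n+N). *)
have [//|/= Hw Hw'] := H [:: (m, n)].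
rewrite !big_seq1 in Hw Hw'; set w := (_ * _)%g in Hw Hw'.
exists (ratr ((cyclic_length (phi w))%:R / (cyclic_length w)%:R)); split.
  eexists; last reflexivity.
  exists w => //=; rewrite -cyclic_length_gt0 Hw.
  by rewrite addn_gt0 addn_gt0 !muln_gt0 n0 v_gt0 orbT.
by apply: eB; rewrite /ball /= fmorph_div !rmorph_nat Hw Hw'.
Qed.

End TwoDirections.

(** Positive rank supplies a nontrivial element, without which the spectrum would be empty. *)
Lemma distortion_spectrum_preserved k (phi : free_group k -> free_group k) :
    (0 < k)%N -> (forall w, cyclic_length (phi w) = cyclic_length w) ->
  distortion_spectrum phi = [set 1].
Proof.
move=> k0 phiE; apply/seteqP; split=> [q [w /= w1 <-]|q ->].
  by rewrite phiE divff // pnatr_eq0 cyclic_length_eq0.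
pose w : free_group k := fg_letter (Ordinal k0, true).
have w1 : w != 1%g by rewrite -word_eq0.
exists w; first exact: w1.
by rewrite phiE divff // pnatr_eq0 cyclic_length_eq0.
Qed.

End Distortion.

(** * The dichotomy, according to whether [phi] is simple *)

Theorem corollary8 (R : realType) (k : nat) (hk : (2 <= k)%N)
  (phi : {multiplicative free_group k -> free_group k}) (hphi : bijective phi) :
  ((simple_aut phi /\ distortion_spectrum phi = [set 1]) \/
    interior (closure [set (ratr q : R) | q in distortion_spectrum phi]) 1) /\
  (exists w : free_group k, w <> 1%g /\ cyclic_length (phi w) = cyclic_length w).
Proof.
have [sphi|nsphi] := pselect (simple_aut phi).
  have phiE w := simple_cyclic_length w sphi.
  split; last first.
    exists (fg_letter (Ordinal hk, true)); split; last exact: phiE.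
    by apply/eqP; rewrite -word_eq0.
  by left; split=> //; apply: distortion_spectrum_preserved; rewrite // ltnW.
have [v expand_v] : exists v, (cyclic_length v < cyclic_length (phi v))%N.
  apply: contrapT => none; apply: nsphi; apply: nonexpanding_simple => // w.
  by rewrite leqNgt; apply/negP => lt; apply: none; exists w.
have [u shrink_u] : exists u, (cyclic_length (phi u) < cyclic_length u)%N.
  apply: contrapT => none; apply: nsphi; apply: nonshrinking_simple => // w.
  by rewrite leqNgt; apply/negP => lt; apply: none; exists w.
split; last exact: cyclic_length_preserved shrink_u expand_v.
by right; apply: interior_distortion_spectrum shrink_u expand_v R.
Qed.
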